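(* Let $R$ be a polynomial ring over a field and let $I$ be a monomial ideal in $R$. Let $w_1,\ldots,w_n$ be the distinct variables $w$ of $R$ such that $N^{*}(w)\neq\emptyset$. Let $Q\in\operatorname{Ass}(R/I)$ be an embedded associated prime. Then there exist $Q'\in\operatorname{Min}(R/I)$ and variables $z_1,\ldots,z_t$ of $R$ such that $Q=(Q',z_1,z_2,\ldots,z_t)$ and, for each $1\le j\le t$, $z_j\in N^{*}(w_i)$ for some $1\le i\le n$.
   Context: $R$ is a polynomial ring in finitely many variables over a field. For a monomial ideal $I$, $\mathcal{G}(I)$ denotes its set of (minimal) monomial generators. For a variable $x$ and a monomial $M$, $d_x(M)$ is the degree of $x$ in $M$, and $d_x(I)=\max\{d_x(M)\mid M\in\mathcal{G}(I)\}$. For a variable $w$, $$N^{*}(w)=\{z\in R\mid z\text{ is a variable},\ z\neq w,\ \exists M\in\mathcal{G}(I)\text{ with } zw\mid M \text{ and } d_w(M)<d_w(I)\}.$$ $\operatorname{Ass}(R/I)$ is the set of associated primes of $R/I$, $\operatorname{Min}(R/I)$ the set of minimal associated primes (the minimal primes of $I$); an associated prime is embedded if it is not minimal. $(Q',z_1,\ldots,z_t)$ is the ideal generated by $Q'$ and $z_1,\ldots,z_t$. *)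

(* Defs.v *)
From mathcomp Require Import all_boot all_order all_algebra.
From mathcomp Require Import mpoly.

Set Implicit Arguments.
Unset Strict Implicit.
Unset Printing Implicit Defensive.

Import GRing.Theory.
Local Open Scope ring_scope.

Section Ideals.
Variable A : comNzRingType.
Implicit Types (S I P Q : A -> Prop).

(* Unlike [idealr_closed] of ring_quotient, this allows the unit ideal and does
   not require membership to be decidable. *)
Definition is_ideal I : Prop :=
  [/\ I 0,
      forall f g, I f -> I g -> I (f + g)
    & forall a f, I f -> I (a * f)].

Definition ideal_gen S : A -> Prop := fun f =>
  forall J : A -> Prop, is_ideal J -> (forall g, S g -> J g) -> J f.

Definition is_prime_ideal P : Prop :=
  [/\ is_ideal P, ~ P 1 & forall f g, P (f * g) -> P f \/ P g].

(* Ass(A/I): the right-hand side of the equivalence is the annihilator of the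
   class of f in A/I. *)
Definition Ass I P : Prop :=
  is_prime_ideal P /\ exists f, forall g, P g <-> I (g * f).

(* Min(A/I): the inclusion-minimal elements of Ass(A/I). *)
Definition Min I P : Prop :=
  Ass I P /\
  forall P', Ass I P' -> (forall f, P' f -> P f) -> forall f, P f -> P' f.

Definition embedded_prime I P : Prop := Ass I P /\ ~ Min I P.

End Ideals.

Section MonomialIdeals.
Variables (k : fieldType) (n : nat).
Implicit Types (I : {mpoly k[n]} -> Prop) (m : 'X_{1..n}) (w z : 'I_n).

Definition is_monomial_ideal I : Prop :=
  exists S : 'X_{1..n} -> Prop,
    forall f, I f <-> ideal_gen (fun g => exists2 m, S m & g = 'X_[m]) f.

(* m is the exponent of an element of G(I), the minimal monomial generators;
   the order on exponents is divisibility of monomials. *)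
Definition min_gen I m : Prop :=
  I 'X_[m] /\ forall m', (m' <= m)%MM -> I 'X_[m'] -> m' = m.

(* d = d_w(I), the maximum of d_w over G(I). It is stated as a relation; there
   is no such d when G(I) is empty, i.e. when I = 0. *)
Definition is_ideal_deg I w (d : nat) : Prop :=
  (exists2 m, min_gen I m & m w = d) /\ (forall m, min_gen I m -> m w <= d)%N.

(* z belongs to N^*(w). *)
Definition Nstar I w z : Prop :=
  z <> w /\
  exists m d, [/\ min_gen I m, (U_(z) + U_(w) <= m)%MM,
                  is_ideal_deg I w d & (m w < d)%N].

End MonomialIdeals.

(* Main.v *)
Require Import Defs.
From mathcomp Require Import all_boot all_order all_algebra.
From mathcomp Require Import mpoly.
From Stdlib Require Import Classical IndefiniteDescription.

Local Open Scope ring_scope.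

Import GRing.Theory.

(** The idea is that any minimal prime Q' contained in Q works.  Write
    Q = (I : f), and let A be the set of variables lying in Q.  Since I is
    monomial and f is not in I, some monomial M of f is outside I, while x M
    lies in I for every x in A.  Let z in A lie in no N^*(w), and let g be a
    minimal generator of I dividing z M.  As g does not divide M, it contains z.
    It contains no other variable x of A: since z is not in N^*(x), the degree
    of x in g would be the maximal one d_x(I), so that d_x(M) >= d_x(I); but
    then a minimal generator dividing x M and not M has x-degree
    d_x(M) + 1 > d_x(I).  Hence z is the only variable of Q that divides g.  The
    prime Q' contains g, so it contains a variable dividing g; that variable is
    in Q because Q' is, so it is z.

    So every variable of Q that lies in no N^*(w) is already in Q', and adding
    the others to Q' gives all of Q, because an associated prime of a monomial
    ideal is generated by variables ([ass_mem_var]).  The latter also makes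
    minimal primes below Q exist, by descent on the number of variables
    ([exists_Min_below]).  The one finiteness fact is that d_x(I) exists as soon
    as I has a minimal generator: this is Dickson's lemma, in the form that a
    sequence of exponents has a componentwise nondecreasing subsequence
    ([nondecreasing_subsequence]). *)

(** * Classical choice of booleans and maxima *)

Lemma exists_bool_pred (T : Type) (P : T -> Prop) :
  exists p : T -> bool, forall x, p x <-> P x.
Proof.
apply: (functional_choice (fun x (b : bool) => b <-> P x)) => x.
by case: (classic (P x)) => Px; [exists true | exists false].
Qed.

Lemma exists_max (P : nat -> Prop) (b : nat) :
    (exists k, P k) -> (forall k, P k -> (k <= b)%N) ->
  exists2 d, P d & forall k, P k -> (k <= d)%N.
Proof.
have [p pP] := exists_bool_pred nat P.
move=> exP leb.
have exp : exists k, p k by case: exP => k /pP; exists k.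
have lep k : p k -> (k <= b)%N by move/pP/leb.
case: (ex_maxnP exp lep) => d /pP Pd dmax; exists d => // k /pP.
exact: dmax.
Qed.

(** * Dickson's lemma *)

(** Repeatedly pass to a position where the tail of u attains its minimum. *)
Lemma nondecreasing_subsequence_nat (u : nat -> nat) :
  exists phi : nat -> nat, {homo phi : i j / (i < j)%N} /\
    {homo (fun i => u (phi i)) : i j / (i <= j)%N}.
Proof.
have tailmin i : exists j, (i <= j)%N /\ forall k, (j <= k)%N -> (u j <= u k)%N.
  have [v] := ubnP (u i); elim: v i => // v IHv i; rewrite ltnS => le_ui.
  case: (classic (exists2 k, (i <= k)%N & (u k < u i)%N)) => [[k le_ik lt_u]|min_i].
    have [j [le_kj jP]] := IHv k (leq_trans lt_u le_ui).
    by exists j; split=> //; apply: leq_trans le_kj.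
  exists i; split=> // k le_ik; rewrite leqNgt; apply/negP => lt_u.
  by apply: min_i; exists k.
have [s sP] := functional_choice _ tailmin.
pose phi := fix F i := if i is i'.+1 then s (F i').+1 else s 0%N.
have lt_phi i : (phi i < phi i.+1)%N by case: (sP (phi i).+1).
have phi_min i k : (phi i <= k)%N -> (u (phi i) <= u k)%N.
  by case: i => [|i]; [case: (sP 0%N) | case: (sP (phi i).+1)] => _; apply.
exists phi; split; first exact: homo_ltn ltn_trans lt_phi.
by apply: homo_leq leq_trans _ => // i; apply/phi_min/ltnW.
Qed.

Lemma nondecreasing_subsequence (n : nat) (u : nat -> 'X_{1..n}) :
  exists phi : nat -> nat, {homo phi : i j / (i < j)%N} /\
    forall i j, (i <= j)%N -> (u (phi i) <= u (phi j))%MM.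
Proof.
suff [phi [inc_phi phiP]] : exists phi : nat -> nat,
    {homo phi : i j / (i < j)%N} /\
    forall x, x \in enum 'I_n -> {homo (fun i => u (phi i) x) : i j / (i <= j)%N}.
  exists phi; split=> // i j le_ij; apply/mnm_lepP => x.
  by apply: phiP le_ij; rewrite mem_enum.
elim: (enum 'I_n) => [|x s [phi [inc_phi phiP]]]; first by exists id; split.
have [psi [inc_psi psiP]] := nondecreasing_subsequence_nat (fun i => u (phi i) x).
have psi_leq : {homo psi : i j / (i <= j)%N}.
  by apply: homo_leq leq_trans _ => // i; apply/ltnW/inc_psi.
exists (phi \o psi); split=> [i j lt_ij|y]; first exact/inc_phi/inc_psi.
rewrite inE => /orP[/eqP->|ys] i j le_ij; first exact: psiP.
exact/(phiP y ys)/psi_leq.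
Qed.

(** An antichain of exponents has bounded degree in each variable: otherwise it
    contains a sequence of unbounded degree in w, and a nondecreasing
    subsequence is constant. *)
Lemma antichain_bounded (n : nat) (P : 'X_{1..n} -> Prop) (w : 'I_n) :
    (forall m m', P m -> P m' -> (m' <= m)%MM -> m' = m) ->
  exists b, forall m, P m -> (m w <= b)%N.
Proof.
move=> antiP; apply: NNPP => unbounded.
have /functional_choice[u uP] (b : nat) : exists m, P m /\ (b < m w)%N.
  apply: NNPP => nob; apply: unbounded; exists b => m Pm.
  by rewrite leqNgt; apply/negP => lt_b; apply: nob; exists m.
have [phi [inc_phi phiP]] := nondecreasing_subsequence n u.
have le_phi i : (i <= phi i)%N.
  by elim: i => // i IHi; apply: leq_ltn_trans IHi (inc_phi _ _ _).
set b := u (phi 0%N) w.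
have eq_u : u (phi 0%N) = u (phi b).
  have [[Pb _] [P0 _]] := (uP (phi b), uP (phi 0%N)).
  exact: antiP Pb P0 (phiP _ _ (leq0n b)).
have [_] := uP (phi b).
by rewrite -eq_u ltnNge le_phi.
Qed.

(** * Monomial ideals *)

Section Monomial.
Variables (k : fieldType) (n : nat).
Implicit Types (I P Q : {mpoly k[n]} -> Prop) (m : 'X_{1..n}) (x z : 'I_n).

(** The usual intrinsic form of being a monomial ideal; unlike a generating
    set of monomials, it can be used one term at a time. *)
Definition termwise I : Prop :=
  is_ideal I /\ forall f, I f -> forall m, m \in msupp f -> I 'X_[m].

Lemma ideal_gen_is_ideal (A : comNzRingType) (S : A -> Prop) :
  is_ideal (ideal_gen S).
Proof.
split=> [J [] // | f g If Ig J idJ SJ | a f If J idJ SJ].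
  by case: (idJ) => _ JD _; apply: JD; [apply: If | apply: Ig].
by case: (idJ) => _ _ JM; apply: JM; apply: If.
Qed.

Lemma ideal_sum I (T : eqType) (s : seq T) (F : T -> {mpoly k[n]}) :
  is_ideal I -> (forall i, i \in s -> I (F i)) -> I (\sum_(i <- s) F i).
Proof.
move=> [I0 ID _] IF; rewrite big_seq.
by elim/big_rec: _ => // i y /IF; apply: ID.
Qed.

Lemma idealZ I c f : is_ideal I -> I f -> I (c *: f).
Proof. by move=> [_ _ IM] If; rewrite -mul_mpolyC; apply: IM. Qed.

Lemma ideal_mnm_le I m m' :
  is_ideal I -> (m <= m')%MM -> I 'X_[m] -> I 'X_[m'].
Proof. by move=> [_ _ IM] /submK <- Im; rewrite mpolyXD; apply: IM. Qed.

Lemma ideal_terms I f :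
  is_ideal I -> (forall m, m \in msupp f -> I 'X_[m]) -> I f.
Proof.
move=> idI If; rewrite [f]mpolyE; apply: ideal_sum => // m /If.
exact: idealZ.
Qed.

Lemma monomial_ideal_termwise I : is_monomial_ideal I -> termwise I.
Proof.
case=> S IS.
have idI : is_ideal I.
  have [G0 GD GM] := ideal_gen_is_ideal _ (fun g : {mpoly k[n]} =>
    exists2 m, S m & g = 'X_[m]).
  by split=> [|f g /IS If /IS Ig|a f /IS If]; apply/IS; [|apply: GD|apply: GM].
split=> // f /IS If m mf.
(* The polynomials all of whose monomials are multiples of elements of S form
   an ideal containing the generators. *)
pose J (g : {mpoly k[n]}) :=
  forall m, m \in msupp g -> exists2 s, S s & (s <= m)%MM.
have [|g [s Ss ->]|s Ss le_sm] := If J _ _ m mf.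
- split=> [m'|g h Jg Jh m'|a g Jg m']; first by rewrite msupp0.
    by move/msuppD_le; rewrite mem_cat => /orP[/Jg|/Jh].
  move/msuppM_le/allpairsP => [[m1 m2] /= [_ /Jg[s Ss le_s] ->]].
  by exists s => //; apply: lepm_trans le_s (lem_addl _ _).
- by move=> m'; rewrite msuppX inE => /eqP->; exists s => //; apply: lepm_refl.
- apply: ideal_mnm_le le_sm _ => //.
  by apply/IS => K _; apply; exists s.
Qed.

(** The leading term of f is multiplied into I by that of g; removing it from f
    leaves a multiple with fewer terms that is still sent into I by g. *)
Lemma lead_pow_annihilates I f g :
    termwise I -> g != 0 -> I (g * f) ->
  exists N, I ('X_[mlead g] ^+ N * f).
Proof.
move=> [idI termI] g_neq0; have [I0 ID IM] := idI.
have [N] := ubnP (size (msupp f)); elim: N f => // N IHN f.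
rewrite ltnS => le_f Igf; have [->|f_neq0] := eqVneq f 0.
  by exists 0%N; rewrite mulr0.
set l := f@_(mlead f) *: 'X_[mlead f]; set u := 'X_[mlead g].
have Iul : I (u * l).
  rewrite -scalerAr; apply: idealZ => //; rewrite -mpolyXD.
  apply: termI Igf _ _; rewrite -mleadM //.
  by rewrite mlead_supp // mulf_neq0.
have [||M IMf] := IHN ((f - l) * u).
- rewrite (perm_size (msuppMX _ _)) size_map (perm_size (msupp_rem _ _)).
  rewrite size_rem ?mlead_supp //; apply: leq_trans le_f.
  by rewrite prednK // lt0n size_eq0 msupp_eq0.
- have -> : g * ((f - l) * u) = u * (g * f) + (- g) * (u * l).
    by rewrite mulrBl mulrBr mulNr [f * u]mulrC [l * u]mulrC mulrCA.
  by apply: ID; apply: IM.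
exists M.+1.
have -> : u ^+ M.+1 * f = u ^+ M * ((f - l) * u) + u ^+ M * (u * l).
  by rewrite -mulrDr [(f - l) * u]mulrC -mulrDr subrK mulrA -exprSr.
by apply: ID => //; apply: IM.
Qed.

Lemma prime_pow (A : comNzRingType) (P : A -> Prop) a N :
  is_prime_ideal P -> P (a ^+ N) -> P a.
Proof.
move=> [_ P1 PM]; elim: N => [/P1 //|N IHN].
by rewrite exprS => /PM[].
Qed.

Lemma prime_mnm_var P m :
  is_prime_ideal P -> P 'X_[m] -> exists2 x, (0 < m x)%N & P 'X_x.
Proof.
move=> primeP; have [_ P1 PM] := primeP; rewrite mpolyXE_id.
elim/big_rec: _ => [/P1 //|x y _ IHy /PM[Px|/IHy //]].
exists x; last exact: prime_pow Px.
by case: (m x) Px => // /P1.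
Qed.

(** For g in Q = (I : f), a power of the leading monomial of g sends f into I,
    hence lies in Q, and so does the leading monomial as Q is prime; subtract
    the leading term from g and repeat. *)
Lemma ass_termwise I Q : termwise I -> Ass I Q -> termwise Q.
Proof.
move=> tI [primeQ [f Qf]]; have [idQ _ _] := primeQ; have [Q0 QD QM] := idQ.
split=> // g; have [N] := ubnP (size (msupp g)).
elim: N g => // N IHN g; rewrite ltnS => le_g Qg m mg.
have g_neq0 : g != 0 by apply: contraTneq mg => ->; rewrite msupp0.
have Qlead : Q 'X_[mlead g].
  have [M] := lead_pow_annihilates _ _ _ tI g_neq0 (proj1 (Qf g) Qg).
  by move/Qf; apply: prime_pow.
have [->//|m_neq] := eqVneq m (mlead g).
apply: (IHN (g - g@_(mlead g) *: 'X_[mlead g])).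
- rewrite (perm_size (msupp_rem _ _)) size_rem ?mlead_supp //.
  apply: leq_trans le_g.
  by rewrite prednK // lt0n size_eq0 msupp_eq0.
- by rewrite -scaleNr; apply: QD => //; apply: idealZ.
- by rewrite (perm_mem (msupp_rem _ _)) mem_rem_uniq ?msupp_uniq // inE m_neq.
Qed.

(** The converse is [prime_mem_var], so Q is generated by the variables it
    contains: its elements have their monomials in Q, and Q is prime. *)
Lemma ass_mem_var I Q f m :
    termwise I -> Ass I Q -> Q f -> m \in msupp f ->
  exists2 x, (0 < m x)%N & Q 'X_x.
Proof.
move=> tI assQ Qf mf; have [_ tQ] := ass_termwise _ _ tI assQ.
by apply: prime_mnm_var (tQ _ Qf _ mf); case: assQ.
Qed.

Lemma prime_mem_var P f :
    is_ideal P -> (forall m, m \in msupp f -> exists2 x, (0 < m x)%N & P 'X_x) ->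
  P f.
Proof.
move=> idP varP; apply: ideal_terms => // m /varP[x m_gt0].
by apply: ideal_mnm_le => //; rewrite lep1mP -lt0n.
Qed.

(** An associated prime strictly below another one contains strictly fewer
    variables, so the descent to a minimal one terminates. *)
Lemma exists_Min_below I Q :
    termwise I -> Ass I Q ->
  exists Q', Min I Q' /\ forall f, Q' f -> Q f.
Proof.
move=> tI.
have [p pP] := exists_bool_pred _ (fun Px : ({mpoly k[n]} -> Prop) * 'I_n =>
  Px.1 'X_(Px.2)).
pose vars P := [set x | p (P, x)].
have [N] := ubnP #|vars Q|; elim: N Q => // N IHN Q; rewrite ltnS => le_Q assQ.
case: (classic (Min I Q)) => [minQ|notmin]; first by exists Q.
have [P [assP PQ notQP]] : exists P,
    [/\ Ass I P, forall f, P f -> Q f & ~ forall f, Q f -> P f].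
  apply: NNPP => noP; apply: notmin; split=> // P assP PQ.
  by apply: NNPP => notQP; apply: noP; exists P.
have [|Q' [minQ' Q'P]] := IHN P _ assP; last by exists Q'; split=> // f /Q'P/PQ.
apply: leq_trans le_Q; apply: proper_card; apply/properP; split.
  by apply/subsetP => x; rewrite !inE => /pP/PQ Qx; apply/pP.
apply: NNPP => novar; apply: notQP => f Qf.
have [[idP _ _] _] := assP.
apply: prime_mem_var => // m mf.
have [x m_gt0 Qx] := ass_mem_var _ _ _ _ tI assQ Qf mf.
exists x => //; apply: NNPP => notPx; apply: novar; exists x; rewrite inE.
  exact/pP.
by apply/negP => /pP.
Qed.

(** * Minimal generators *)

Lemma exists_min_gen_below I m :
  I 'X_[m] -> exists2 g, min_gen I g & (g <= m)%MM.
Proof.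
have [N] := ubnP (mdeg m); elim: N m => // N IHN m; rewrite ltnS => le_m Im.
case: (classic (min_gen I m)) => [gm|notgen]; first by exists m => //; apply: lepm_refl.
have [m' [le_m' Im' m'_neq]] : exists m',
    [/\ (m' <= m)%MM, I 'X_[m'] & m' <> m].
  apply: NNPP => nom'; apply: notgen; split=> // m' le_m' Im'.
  by apply: NNPP => m'_neq; apply: nom'; exists m'.
have [|g gg le_g] := IHN m' _ Im'; last by exists g => //; apply: lepm_trans le_m'.
apply: leq_trans le_m; rewrite -(submK le_m') mdegD -[ltnLHS]add0n ltn_add2r.
rewrite lt0n mdeg_eq0; apply/eqP => d0; apply: m'_neq.
by rewrite -(submK le_m') d0 add0m.
Qed.

Lemma exists_ideal_deg I x m : min_gen I m -> exists d, is_ideal_deg I x d.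
Proof.
move=> gm.
have [|b leb] := antichain_bounded n (min_gen I) x.
  by move=> m1 m2 [_ min1] [I2 _] /min1; apply.
have [||d [m' gm' <-] dmax] :=
  exists_max (fun d => exists2 m', min_gen I m' & m' x = d) b.
- by exists (m x); exists m.
- by move=> d [m' gm' <-]; apply: leb.
exists (m' x); split=> [|m'' gm'']; first by exists m'.
by apply: dmax; exists m''.
Qed.

(** A generator dividing x M but not M has to use the exponent of x in x M in
    full; this is where degrees of generators are compared with those of M. *)
Lemma min_gen_step I m x :
    is_ideal I -> ~ I 'X_[m] -> I 'X_[U_(x) + m] ->
  exists g, [/\ min_gen I g, (g <= U_(x) + m)%MM & g x = (m x).+1].
Proof.
move=> idI Im /exists_min_gen_below[g gg le_g]; exists g; split=> //.
have /mnm_lepP le_gE := le_g.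
apply/eqP; rewrite eqn_leq; have := le_gE x; rewrite mnmDE mnm1E eqxx => -> /=.
rewrite ltnNge; apply/negP => le_x; case: gg => Ig _; apply: Im.
apply: ideal_mnm_le Ig => //; apply/mnm_lepP => y.
have [<-//|neq] := eqVneq x y.
by have := le_gE y; rewrite mnmDE mnm1E (negbTE neq).
Qed.

(** With Q = (I : f), any monomial of f outside I will do: I contains x f, hence
    each of its monomials. *)
Lemma ass_witness I Q :
    termwise I -> Ass I Q ->
  exists2 m, ~ I 'X_[m] & forall x, Q 'X_x -> I 'X_[U_(x) + m].
Proof.
move=> [idI termI] [[_ Q1 _] [f Qf]].
have [m mf Im] : exists2 m, m \in msupp f & ~ I 'X_[m].
  apply: NNPP => nom; apply: Q1; apply/Qf; rewrite mul1r.
  apply: ideal_terms => // m mf.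
  by apply: NNPP => Im; apply: nom; exists m.
exists m => // x /Qf Ixf; apply: termI Ixf _ _.
by rewrite mulrC (perm_mem (msuppMX _ _)) map_f.
Qed.

(** Some minimal generator of I has z as its only variable in Q, by maximality
    of its degrees in its other variables; P contains one of its variables. *)
Lemma var_mem_subprime I P Q z :
    termwise I -> Ass I Q -> Ass I P -> (forall f, P f -> Q f) -> Q 'X_z ->
    (forall x, ~ Nstar I x z) ->
  P 'X_z.
Proof.
move=> tI assQ [primeP [h Ph]] PQ Qz notN.
have [idI _] := tI; have [_ _ IM] := idI.
have [m Im QI] := ass_witness _ _ tI assQ.
have [g [gg /mnm_lepP le_g gz]] := min_gen_step _ _ _ idI Im (QI _ Qz).
have Pg : P 'X_[g] by apply/Ph; rewrite mulrC; apply: IM; case: gg.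
have [x gx_gt0 Px] := prime_mnm_var _ _ primeP Pg.
have [<-//|x_neq] := eqVneq x z.
have [d degd] := exists_ideal_deg _ x _ gg.
have le_dg : (d <= g x)%N.
  rewrite leqNgt; apply/negP => lt_gd; apply: (notN x); split.
    by move=> zx; rewrite zx eqxx in x_neq.
  exists g, d; split=> //; apply/mnm_lepP => y; rewrite mnmDE !mnm1E.
  have [<-|_] := eqVneq z y; first by rewrite (negbTE x_neq) gz.
  by have [<-|] := eqVneq x y.
have [g' [gg' _ g'x]] := min_gen_step _ _ _ idI Im (QI _ (PQ _ Px)).
have := le_g x; rewrite mnmDE mnm1E eq_sym (negbTE x_neq) add0n => le_gm.
have := proj2 degd _ gg'; rewrite g'x => lt_md.
by have := leq_trans lt_md (leq_trans le_dg le_gm); rewrite ltnn.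
Qed.

End Monomial.

Theorem theorem2p11 (k : fieldType) (n : nat) (I : {mpoly k[n]} -> Prop)
    (HI : is_monomial_ideal I)
    (r : nat) (w : 'I_r -> 'I_n) (w_inj : injective w)
    (Hw : forall x : 'I_n, (exists i : 'I_r, w i = x) <-> (exists z, Nstar I x z))
    (Q : {mpoly k[n]} -> Prop) (HQ : embedded_prime I Q) :
  exists (Q' : {mpoly k[n]} -> Prop) (t : nat) (z : 'I_t -> 'I_n),
    [/\ Min I Q',
        forall f : {mpoly k[n]},
          Q f <-> ideal_gen (fun g => Q' g \/ exists j : 'I_t, g = 'X_(z j)) f
      & forall j : 'I_t, exists i : 'I_r, Nstar I (w i) (z j)].
Proof.
have tI := monomial_ideal_termwise _ _ _ HI.
case: HQ => assQ _.
have [Q' [minQ' Q'Q]] := exists_Min_below _ _ _ _ tI assQ.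
have [p pP] := exists_bool_pred _ (fun x => Q 'X_x /\ exists y, Nstar I y x).
pose Z := [set x | p x].
have ZP (j : 'I_#|Z|) : Q 'X_(enum_val j) /\ exists y, Nstar I y (enum_val j).
  by apply/pP; have := enum_valP j; rewrite inE.
exists Q', #|Z|, enum_val; split=> // [f|j]; last first.
  have [_ [y Ny]] := ZP j.
  by have [|i yi] := proj2 (Hw y); [exists (enum_val j) | exists i; rewrite yi].
have [[idQ _ _] _] := assQ.
split=> [Qf|]; last by apply=> // g [/Q'Q //|[j ->]]; case: (ZP j).
apply: prime_mem_var => [|m mf]; first exact: ideal_gen_is_ideal.
have [x m_gt0 Qx] := ass_mem_var _ _ _ _ _ _ tI assQ Qf mf.
exists x => // J idJ; apply.
case: (classic (exists y, Nstar I y x)) => [Nx|notN].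
  have Zx : x \in Z by rewrite inE; apply/pP.
  by right; exists (enum_rank_in Zx x); rewrite enum_rankK_in.
left; have [assQ' _] := minQ'.
apply: var_mem_subprime tI assQ assQ' Q'Q Qx _ => y Ny.
by apply: notN; exists y.
Qed.
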